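(* Let $A$ be an Abelian group and let $G=(V,E)$ be a finite weakly connected directed graph (loops and multiple edges allowed). Let $\mathcal{HR}(E,A)$ be the group of balanced functions on the edges of $G$ in the rigid case, let $\bar{k}(G)$ be the number of strongly connected components of $G$, and let $r(G)$ be the number of all edges of $G$ which go from a vertex in one strongly connected component of $G$ to a vertex in a different strongly connected component of $G$. Then the group $\mathcal{HR}(E,A)$ is isomorphic to $A^{|V|-\bar{k}(G)+r(G)}$.
   Context: The Abelian group $A$ is written additively with identity $0$. A directed graph $G=(V,E)$ has a nonempty vertex set $V$ and a set $E$ of directed edges, each with an origin and an endpoint in $V$; loops and multiple edges are allowed. It is weakly connected if its underlying undirected graph is connected. Rigid case (edges may be traversed only along their direction). A path from a vertex $x$ to a vertex $y$ is an alternating sequence $v_1,e_1,v_2,e_2,\dots,v_n,e_n$ of vertices from $V$ and pairwise different edges from $E$ such that $v_1=x$, each $e_j$ for $j=1,\dots,n-1$ goes from $v_j$ to $v_{j+1}$, and $e_n$ goes from $v_n$ to $y$; vertices may repeat. A cycle is a path from a vertex to itself. A function $f:E\to A$ is called balanced if $f(e_1)+\dots+f(e_n)=0$ for every cycle $v_1,e_1,\dots,v_n,e_n$ of $G$. The set $\mathcal{HR}(E,A)$ of all balanced functions $f:E\to A$ is a group under pointwise addition. Two vertices $x,y$ are strongly connected if there exist a path from $x$ to $y$ and a path from $y$ to $x$ (these may share edges); every vertex is strongly connected to itself. This is an equivalence relation on $V$; its equivalence classes, together with all the edges between the vertices of each class, are the strongly connected components of $G$. *)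

(* Defs.v *)
From HB Require Import structures.
From mathcomp Require Import all_boot all_algebra.
From mathcomp Require Import boolp.

Set Implicit Arguments.
Unset Strict Implicit.
Unset Printing Implicit Defensive.

Import GRing.Theory.

Local Open Scope ring_scope.

Record digraph := Digraph {
  vertex : finType;
  edge : finType;
  origin : edge -> vertex;
  endpoint : edge -> vertex;
  vertex_nonempty : (0 < #|vertex|)%N
}.

Definition weakly_connected (G : digraph) : Prop :=
  forall x y : vertex G,
    connect (fun u v => [exists e : edge G,
      ((origin e == u) && (endpoint e == v))
      || ((origin e == v) && (endpoint e == u))]) x y.

(* The alternating sequence v_1, e_1, ..., v_n, e_n is encoded as the sequence
   of pairs (v_1, e_1), ..., (v_n, e_n). *)
Fixpoint walk (G : digraph) (x : vertex G) (p : seq (vertex G * edge G))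
    (y : vertex G) : bool :=
  if p is (v, e) :: p' then
    [&& v == x, origin e == v & walk (endpoint e) p' y]
  else x == y.

Definition is_path (G : digraph) (x : vertex G) (p : seq (vertex G * edge G))
    (y : vertex G) : bool :=
  [&& p != [::], uniq [seq ve.2 | ve <- p] & walk x p y].

Definition is_cycle (G : digraph) (p : seq (vertex G * edge G)) : Prop :=
  exists x : vertex G, is_path x p x.

Definition balanced (G : digraph) (A : zmodType) (f : {ffun edge G -> A}) :
    Prop :=
  forall p : seq (vertex G * edge G), is_cycle p -> \sum_(ve <- p) f ve.2 = 0.

Definition balancedb (G : digraph) (A : zmodType) :
    {pred {ffun edge G -> A}} :=
  fun f => `[< balanced f >].

Lemma balanced_zmod_closed (G : digraph) (A : zmodType) :
  zmod_closed (@balancedb G A).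
Proof.
split=> [|f g /asboolP bf /asboolP bg]; apply/asboolP => p cp.
  by rewrite big1 // => ve _; rewrite ffunE.
under eq_bigr do rewrite !ffunE.
by rewrite sumrB bf // bg // subr0.
Qed.

HB.instance Definition _ (G : digraph) (A : zmodType) :=
  GRing.isZmodClosed.Build {ffun edge G -> A} (@balancedb G A)
    (@balanced_zmod_closed G A).

Record HR (G : digraph) (A : zmodType) := MkHR {
  HR_val : {ffun edge G -> A};
  HR_valP : HR_val \in @balancedb G A
}.

HB.instance Definition _ (G : digraph) (A : zmodType) :=
  [isSub for @HR_val G A].
HB.instance Definition _ (G : digraph) (A : zmodType) :=
  [Choice of HR G A by <:].
HB.instance Definition _ (G : digraph) (A : zmodType) :=
  [SubChoice_isSubZmodule of HR G A by <:].

(* Paths are nonempty, so reflexivity has to be imposed separately. *)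
Definition strongly_connected (G : digraph) (x y : vertex G) : Prop :=
  x = y \/
  (exists p, is_path x p y) /\ (exists q, is_path y q x).

(* The vertex sets of the strongly connected components. *)
Definition scc (G : digraph) : {set {set vertex G}} :=
  equivalence_partition (fun x y => `[< strongly_connected x y >])
    [set: vertex G].

Definition kbar (G : digraph) : nat := #|scc G|.

(* Hence the truncated subtraction #|vertex G| - kbar G is exact. *)
Lemma kbar_le (G : digraph) : (kbar G <= #|vertex G|)%N.
Proof. by rewrite -cardsT; apply: leq_imset_card. Qed.

Definition cross_edges (G : digraph) : {set edge G} :=
  [set e | [exists C in scc G, exists D in scc G,
    [&& C != D, origin e \in C & endpoint e \in D]]].

Definition rcross (G : digraph) : nat := #|cross_edges G|.

Definition isomorphic (U W : zmodType) : Prop :=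
  exists phi : {additive U -> W}, bijective phi.

(* Main.v *)
Require Import Defs.
From HB Require Import structures.
From mathcomp Require Import all_boot all_algebra.
From mathcomp Require Import boolp.

(** Inside a strongly connected component a balanced function is a coboundary.
    A closed walk that repeats an edge splits into two shorter closed walks, so
    the sum of a balanced [f] vanishes along every closed walk and not only
    along the edge-simple ones ([closed_walk_sum0]).  Hence, when [y] leads back
    to [x], the sum along a walk from [x] to [y] depends only on [x] and [y]
    ([walk_sum_unique]): close up both walks with the same return.  Fixing one
    root in each component and summing [f] from the root gives a potential [h]
    on the vertices, zero at the roots, with [f e = h (endpoint e) - h (origin
    e)] on every edge inside a component.

    An edge [e] between two components lies on no closed walk, since the rest of
    the walk would lead from its endpoint back to its origin.  So balancedness
    says nothing about the value of [f] there.  Conversely, arbitrary values on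
    the cross edges and an arbitrary potential vanishing at the roots give a
    balanced function, because the sum of the differences of [h] along a cycle
    telescopes ([walk_sum_potential]).

    A balanced function is therefore the same thing as a function on the
    disjoint union of the non-root vertices, of which there are the number of
    vertices minus the number of components, and the cross edges. *)

Set Implicit Arguments.
Unset Strict Implicit.
Unset Printing Implicit Defensive.

Import GRing.Theory.

(** * Walks *)

Section Walks.
Variable G : digraph.
Implicit Types (e : edge G) (x y z : vertex G) (p q : seq (vertex G * edge G)).

Definition reachable x y : Prop := exists p, walk x p y.

Lemma walk_cat x p q y :
  walk x (p ++ q) y <-> exists2 z, walk x p z & walk z q y.
Proof.
elim: p x => [|[v e] p IHp] x /=.
  by split=> [w|[z /eqP->]]; first exists x.
split=> [/and3P[-> -> /IHp[z wp wq]]|[z /and3P[-> -> wp] wq]]; first by exists z.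
by apply/IHp; exists z.
Qed.

Lemma walk_edge e : walk (origin e) [:: (origin e, e)] (endpoint e).
Proof. by rewrite /= !eqxx. Qed.

Lemma reachable_refl x : reachable x x.
Proof. by exists [::] => /=. Qed.

Lemma reachable_trans y x z : reachable x y -> reachable y z -> reachable x z.
Proof. by move=> [p wp] [q wq]; exists (p ++ q); apply/walk_cat; exists y. Qed.

Lemma reachable_edge e : reachable (origin e) (endpoint e).
Proof. by exists [:: (origin e, e)]; apply: walk_edge. Qed.

(** Between two passages through the same edge a walk runs in a loop, and cutting
    that loop out leaves a walk with the same ends.  Both pieces are shorter, so
    this drives the inductions that reduce walks to edge-simple ones. *)
Lemma walk_excise x p y :
    walk x p y -> ~~ uniq [seq ve.2 | ve <- p] ->
  exists v c q, [/\ walk v c v, walk x q y, size c < size p, size q < size p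
                  & perm_eq p (c ++ q)].
Proof.
elim: p x => [|[v e] p IHp] x //= /and3P[/eqP-> /eqP<- wp].
rewrite negb_and negbK => /orP[/mapP[[v' e'] + /= ee']|/(IHp _ wp)].
  rewrite -{e'}ee' => vp; case/splitPr: vp wp => p1 p2 /walk_cat[z w1].
  rewrite /= => /and3P[/eqP v'z /eqP oe w2]; rewrite -{z}v'z -{v'}oe in w1 *.
  exists (origin e), ((origin e, e) :: p1), ((origin e, e) :: p2).
  split; rewrite /= ?eqxx // size_cat ltnS /=; last exact: leq_addl.
  by rewrite addnS ltnS leq_addr.
move=> [u [c [q [wc wq szc szq pcq]]]]; exists u, c, ((origin e, e) :: q).
split=> //=; first by rewrite !eqxx.
- exact: leq_trans szc _.
- by rewrite -(cat1s _ q) perm_sym perm_catCA /= perm_cons perm_sym.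
Qed.

Lemma walk_is_path x p y : walk x p y -> x = y \/ exists q, is_path x q y.
Proof.
have [n] := ubnP (size p); elim: n p => // n IHn p; rewrite ltnS => szp wp.
have [up|/(walk_excise wp)] := boolP (uniq [seq ve.2 | ve <- p]).
  case: p => [|ve p] in szp wp up *; first by left; apply/eqP.
  by right; exists (ve :: p); rewrite /is_path up.
by move=> [v [c [q [_ wq _ szq _]]]]; apply: IHn wq; apply: leq_trans szp.
Qed.

Lemma path_reachable x y : (exists p, is_path x p y) -> reachable x y.
Proof. by move=> [p /and3P[_ _ wp]]; exists p. Qed.

(** Stating strong connectedness through walks turns both transitivity and the
    behaviour of edges lying on closed walks into concatenations. *)
Lemma strongly_connectedP x y :
  strongly_connected x y <-> reachable x y /\ reachable y x.
Proof.
split=> [[->|[/path_reachable xy /path_reachable yx]]|[[p wp] [q wq]]].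
- by split; apply: reachable_refl.
- by split.
- case: (walk_is_path wp) => [|pxy]; first by left.
  by case: (walk_is_path wq) => [|qyx]; [left | right].
Qed.

Lemma strongly_connected_equiv :
  {in [set: vertex G] & &,
    equivalence_rel (fun x y => `[< strongly_connected x y >])}.
Proof.
move=> x y z _ _ _; split.
  by apply/asboolP/strongly_connectedP; split; apply: reachable_refl.
move=> /asboolP/strongly_connectedP[xy yx].
apply/asboolP/asboolP => /strongly_connectedP[h1 h2];
  apply/strongly_connectedP; split;
  by [apply: reachable_trans h1 | apply: reachable_trans h2 _].
Qed.

(** * Components, cross edges and roots *)

Lemma scc_partition : partition (scc G) [set: vertex G].
Proof. exact: equivalence_partitionP strongly_connected_equiv. Qed.

Lemma pblock_scc_mem x : pblock (scc G) x \in scc G.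
Proof. by rewrite pblock_mem // (cover_partition scc_partition). Qed.

Lemma pblock_sccP x y :
  reflect (strongly_connected x y) (y \in pblock (scc G) x).
Proof.
rewrite (pblock_equivalence_partition strongly_connected_equiv) //.
exact: asboolP.
Qed.

(** The edge itself leads from its origin to its endpoint, so its ends are in
    different components exactly when there is no way back. *)
Lemma cross_edgesP e :
  reflect (~ reachable (endpoint e) (origin e)) (e \in cross_edges G).
Proof.
have trS : trivIset (scc G) by case/and3P: scc_partition.
have covS z : z \in cover (scc G) by rewrite (cover_partition scc_partition).
rewrite inE; apply: (iffP idP) => [|nr].
  case/exists_inP=> C CS /exists_inP[D DS /and3P[neqCD oC eD]] r.
  case/negP: neqCD; rewrite -(def_pblock trS CS oC) -(def_pblock trS DS eD).
  rewrite eq_pblock //; apply/pblock_sccP/strongly_connectedP; split=> //.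
  exact: reachable_edge.
have memS := pblock_scc_mem.
apply/exists_inP; exists (pblock (scc G) (origin e)) => //.
apply/exists_inP; exists (pblock (scc G) (endpoint e)) => //.
rewrite !mem_pblock !covS !andbT eq_pblock //.
by apply/pblock_sccP => /strongly_connectedP[_ /nr].
Qed.

Definition roots : {set vertex G} := transversal (scc G) [set: vertex G].

Definition root x : vertex G :=
  transversal_repr x roots (pblock (scc G) x).

Lemma roots_transversal : is_transversal roots (scc G) [set: vertex G].
Proof. exact: transversalP scc_partition. Qed.

Lemma root_mem x : root x \in roots.
Proof. exact: repr_mem_transversal roots_transversal _ _ (pblock_scc_mem x). Qed.

Lemma root_strongly_connected x : strongly_connected x (root x).
Proof.
by apply/pblock_sccP/(repr_mem_pblock roots_transversal)/pblock_scc_mem.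
Qed.

Lemma root_reachable x : reachable (root x) x.
Proof. by case/strongly_connectedP: (root_strongly_connected x). Qed.

Lemma reachable_root x : reachable x (root x).
Proof. by case/strongly_connectedP: (root_strongly_connected x). Qed.

Lemma root_id x : x \in roots -> root x = x.
Proof. by move=> xR; apply: (pblockK roots_transversal). Qed.

Lemma eq_root x y : strongly_connected x y -> root x = root y.
Proof.
move=> sxy; have trS : trivIset (scc G) by case/and3P: scc_partition.
have /eqP eqB : pblock (scc G) x == pblock (scc G) y.
  by rewrite eq_pblock ?(cover_partition scc_partition) //; apply/pblock_sccP.
(* rewriting with eqB is not enough: the default vertices x and y differ *)
apply: (pblock_inj roots_transversal); rewrite ?root_mem //.
by rewrite !(transversal_reprK roots_transversal) ?pblock_scc_mem.
Qed.

Lemma card_nonroots : #|~: roots| = #|vertex G| - kbar G.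
Proof.
by rewrite -(cardsC roots) (card_transversal roots_transversal) addKn.
Qed.

End Walks.

(** * Sums along walks *)

Section WalkSums.
Variables (G : digraph) (A : zmodType).
Implicit Types (f : {ffun edge G -> A}) (e : edge G) (x y : vertex G).
Local Open Scope ring_scope.

Definition walk_sum f (p : seq (vertex G * edge G)) : A := \sum_(ve <- p) f ve.2.

Lemma walk_sum_cat f p q : walk_sum f (p ++ q) = walk_sum f p + walk_sum f q.
Proof. exact: big_cat. Qed.

Lemma walk_sum1 f v e : walk_sum f [:: (v, e)] = f e.
Proof. exact: big_seq1. Qed.

Lemma walk_sumB f g p : walk_sum (f - g) p = walk_sum f p - walk_sum g p.
Proof. by rewrite /walk_sum -sumrB; apply: eq_bigr => ve _; rewrite !ffunE. Qed.

(** Balancedness only constrains edge-simple closed walks; a repeated edge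
    splits a closed walk into two shorter closed ones. *)
Lemma closed_walk_sum0 f x p : balanced f -> walk x p x -> walk_sum f p = 0.
Proof.
move=> bf; have [n] := ubnP (size p).
elim: n p x => // n IHn p x; rewrite ltnS => szp wp.
have [up|/(walk_excise wp)] := boolP (uniq [seq ve.2 | ve <- p]).
  case: p => [|ve p] in szp wp up *; first exact: big_nil.
  by apply: bf; exists x; rewrite /is_path up.
move=> [v [c [q [wc wq szc szq pcq]]]].
rewrite /walk_sum (perm_big _ pcq) -/(walk_sum f _) walk_sum_cat.
by rewrite (IHn c v) ?(IHn q x) ?addr0 // (leq_trans _ szp).
Qed.

(** Any return from [y] to [x] closes both walks up to closed walks of sum zero,
    and cancels. *)
Lemma walk_sum_unique f x y p q :
    balanced f -> reachable y x -> walk x p y -> walk x q y ->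
  walk_sum f p = walk_sum f q.
Proof.
move=> bf [r wr] wp wq; apply: (addIr (walk_sum f r)).
by rewrite -!walk_sum_cat !(@closed_walk_sum0 f x) //; apply/walk_cat; exists y.
Qed.

(** A walk whose ends lie in one component never leaves that component, so the
    potential controls all of its edges. *)
Lemma walk_sum_potential f (h : vertex G -> A) x p y :
    (forall e, e \notin cross_edges G -> f e = h (endpoint e) - h (origin e)) ->
    reachable y x -> walk x p y -> walk_sum f p = h y - h x.
Proof.
move=> fh; elim: p x => [|[v e] p IHp] x ryx /=.
  by move=> /eqP->; rewrite subrr; apply: big_nil.
move=> /and3P[/eqP-> /eqP oe wp]; rewrite -{v}oe in ryx *.
have rye : reachable y (endpoint e) := reachable_trans ryx (reachable_edge e).
rewrite -cat1s walk_sum_cat walk_sum1 (IHp _ rye wp) fh; last first.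
  apply/cross_edgesP; apply; apply: reachable_trans ryx; by exists p.
by rewrite addrC addrA subrK.
Qed.

Lemma potential_balanced f (h : vertex G -> A) :
    (forall e, e \notin cross_edges G -> f e = h (endpoint e) - h (origin e)) ->
  balanced f.
Proof.
move=> fh p [x /and3P[_ _ wp]].
by rewrite -/(walk_sum f p) (walk_sum_potential fh (reachable_refl x) wp) subrr.
Qed.

(** * The potential of a balanced function *)

Definition root_walk x := projT1 (cid (root_reachable x)).

Lemma root_walkP x : walk (root x) (root_walk x) x.
Proof. exact: projT2 (cid (root_reachable x)). Qed.

Definition potential f x : A := walk_sum f (root_walk x).

Lemma potentialB f g x : potential (f - g) x = potential f x - potential g x.
Proof. exact: walk_sumB. Qed.

Lemma potential_root f x : balanced f -> x \in roots G -> potential f x = 0.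
Proof.
by move=> bf /root_id rx; apply: (closed_walk_sum0 bf (x := x));
   rewrite -{1}rx; apply: root_walkP.
Qed.

(** Both ends of [e] have the same root, so the chosen walk to the origin
    followed by [e] competes with the chosen walk to the endpoint. *)
Lemma balanced_potential f e :
    balanced f -> e \notin cross_edges G ->
  f e = potential f (endpoint e) - potential f (origin e).
Proof.
move=> bf /cross_edgesP/contrapT reo.
have eqr : root (origin e) = root (endpoint e).
  by apply/eq_root/strongly_connectedP; split=> //; apply: reachable_edge.
apply/eqP; rewrite eq_sym subr_eq addrC; apply/eqP.
rewrite -(walk_sum1 f (origin e)) -walk_sum_cat.
apply: walk_sum_unique bf (reachable_root _) (root_walkP _) _.
rewrite -eqr; apply/walk_cat; exists (origin e); first exact: root_walkP.
exact: walk_edge.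
Qed.

(** Potentials on a component differ by a constant, which the value at the root
    fixes; this recovers the vertex parameters from the function they define. *)
Lemma potential_unique f (h : vertex G -> A) x :
    (forall e, e \notin cross_edges G -> f e = h (endpoint e) - h (origin e)) ->
    (forall z, z \in roots G -> h z = 0) ->
  potential f x = h x.
Proof.
move=> fh h0; rewrite /potential.
rewrite (walk_sum_potential fh (reachable_root x) (root_walkP x)).
by rewrite (h0 _ (root_mem x)) subr0.
Qed.

(** * The isomorphism *)

(** The free parameters of a balanced function: a potential value at each
    non-root vertex and a value on each cross edge. *)
Definition parameter : finType :=
  ({x : vertex G | x \in ~: roots G} + {e : edge G | e \in cross_edges G})%type.

Lemma card_parameter : #|{: parameter}| = (#|vertex G| - kbar G + rcross G)%N.
Proof. by rewrite card_sum !card_sig -card_nonroots. Qed.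

Definition parameters_of (f : HR G A) : {ffun parameter -> A} :=
  [ffun j => match j with
             | inl x => potential (val f) (val x)
             | inr e => val f (val e)
             end].

Definition potential_of (g : {ffun parameter -> A}) x : A :=
  if insub x is Some u then g (inl u) else 0.

Definition edge_function_of (g : {ffun parameter -> A}) : {ffun edge G -> A} :=
  [ffun e => if insub e is Some u then g (inr u)
             else potential_of g (endpoint e) - potential_of g (origin e)].

Lemma edge_function_ofE g e :
    e \notin cross_edges G ->
  edge_function_of g e = potential_of g (endpoint e) - potential_of g (origin e).
Proof. by move=> eNc; rewrite ffunE insubF //; apply: negbTE. Qed.

Lemma edge_function_of_balanced g : edge_function_of g \in @balancedb G A.
Proof. by apply/asboolP/potential_balanced/edge_function_ofE. Qed.

Definition balanced_of (g : {ffun parameter -> A}) : HR G A :=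
  MkHR (edge_function_of_balanced g).

Lemma potential_of_root g x : x \in roots G -> potential_of g x = 0.
Proof. by move=> xR; rewrite /potential_of insubF // inE xR. Qed.

Lemma parameters_of_is_zmod_morphism : zmod_morphism parameters_of.
Proof.
by move=> f g; apply/ffunP => -[x|e]; rewrite !ffunE ?potentialB.
Qed.

Lemma balanced_ofK : cancel balanced_of parameters_of.
Proof.
move=> g; apply/ffunP => -[x|e]; rewrite ffunE /=; last by rewrite ffunE valK.
rewrite (potential_unique _ (@edge_function_ofE g) (@potential_of_root g)).
by rewrite /potential_of valK.
Qed.

Lemma parameters_ofK : cancel parameters_of balanced_of.
Proof.
move=> f; apply: val_inj => /=.
have bf : balanced (val f) by apply/asboolP; apply: HR_valP.
have potE x : potential_of (parameters_of f) x = potential (val f) x.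
  rewrite /potential_of; case: insubP => [u _ <-|]; first by rewrite ffunE.
  by rewrite inE negbK => xR; rewrite potential_root.
apply/ffunP => e; have [ec|eNc] := boolP (e \in cross_edges G).
  by rewrite ffunE (insubT (fun e => e \in cross_edges G) ec) ffunE.
by rewrite edge_function_ofE // !potE -balanced_potential.
Qed.

End WalkSums.

Lemma isomorphic_of_cancel (U W : zmodType) (phi : U -> W) (psi : W -> U) :
  zmod_morphism phi -> cancel phi psi -> cancel psi phi -> isomorphic U W.
Proof.
move=> phiB phiK psiK.
pose phiM := GRing.isZmodMorphism.Build U W phi phiB.
pose phiA : {additive U -> W} := HB.pack phi phiM.
by exists phiA; exists psi.
Qed.

Lemma isomorphic_ffun_card (U A : zmodType) (J : finType) n :
    #|J| = n -> isomorphic U {ffun J -> A} ->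
  isomorphic U {ffun 'I_n -> A}.
Proof.
move=> <- [phi [psi phiK psiK]].
apply: (@isomorphic_of_cancel _ _ (fun u => [ffun i => phi u (enum_val i)])
          (fun g => psi [ffun j => g (enum_rank j)])).
- by move=> u v; apply/ffunP => i; rewrite !ffunE raddfB !ffunE.
- move=> u; rewrite -[RHS]phiK; congr psi.
  by apply/ffunP => j; rewrite !ffunE enum_rankK.
- by move=> g; apply/ffunP => i; rewrite ffunE psiK ffunE enum_valK.
Qed.

Theorem theorem3p7 (A : zmodType) (G : digraph) (hG : weakly_connected G) :
  isomorphic (HR G A) {ffun 'I_(#|vertex G| - kbar G + rcross G) -> A}.
Proof.
apply: isomorphic_ffun_card (card_parameter G) _.
exact: isomorphic_of_cancel (@parameters_of_is_zmod_morphism G A)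
         (@parameters_ofK G A) (@balanced_ofK G A).
Qed.
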